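(* Let $X$ be a set, let $\mathcal{A}$ be an algebra of subsets of $X$, and let $m\colon\mathcal{A}\to[0,\infty]$ be a measure on $\mathcal{A}$. Let $$\mathcal{M}:=\{E\subseteq X\colon \forall A\in\mathcal{A}_{\mathsf{fin}}\ \forall\varepsilon>0\ \exists B\in\mathcal{A}\ \ d_A(E,B)<\varepsilon\},$$ which is a $\sigma$-algebra over $X$ containing $\mathcal{A}$. If $m$ is $\sigma$-finite on $\mathcal{A}$, then the $\sigma$-additive extension of $m$ to $\mathcal{M}$ is unique; that is, any measure $\tilde m\colon\mathcal{M}\to[0,\infty]$ with $\tilde m(A)=m(A)$ for all $A\in\mathcal{A}$ coincides with the measure $\bar m:=m^*|_{\mathcal{M}}$.
   Context: A measure on an algebra $\mathcal{A}$ over $X$ is a nonnegative function $m\colon\mathcal{A}\to[0,\infty]$ with $m(\emptyset)=0$ that is $\sigma$-additive: $m(\bigcup_n A_n)=\sum_n m(A_n)$ for every disjoint sequence $(A_n)$ in $\mathcal{A}$ with $\bigcup_n A_n\in\mathcal{A}$. Set $\mathcal{A}_{\mathsf{fin}}:=\{A\in\mathcal{A}\colon m(A)<\infty\}$. The measure $m$ is $\sigma$-finite on $\mathcal{A}$ if there is a disjoint sequence $(D_n)$ in $\mathcal{A}_{\mathsf{fin}}$ with $\bigcup_n D_n=X$. The outer measure corresponding to $m$ is defined for all $E\subseteq X$ by $m^*(E):=\inf\{\sum_{n=1}^\infty m(A_n)\colon (A_n)_{n=1}^\infty \text{ a sequence in }\mathcal{A},\ \bigcup_n A_n\supseteq E\}$.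 For $E,F\subseteq X$, $E+F$ denotes the symmetric difference of $E$ and $F$. For $A\in\mathcal{A}$ and $E,F\subseteq X$, $d_A(E,F):=m^*\big(A\cap(E+F)\big)$. The restriction $\bar m:=m^*|_{\mathcal{M}}$ is a measure on $\mathcal{M}$ extending $m$. *)

(* Defs.v *)
From HB Require Import structures.
From mathcomp Require Import all_boot all_order all_algebra.
From mathcomp Require Import all_classical all_reals all_analysis.

Set Implicit Arguments.
Unset Strict Implicit.
Unset Printing Implicit Defensive.

Local Open Scope classical_set_scope.
Local Open Scope ring_scope.
Local Open Scope ereal_scope.
Local Open Scope measure_scope.

Definition dist_on d (X : algebraOfSetsType d) (R : realType)
    (m : set X -> \bar R) (A E F : set X) : \bar R :=
  m^* (A `&` (E `+` F)).

Definition fin_approximable d (X : algebraOfSetsType d) (R : realType)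
    (m : set X -> \bar R) : set (set X) :=
  [set E | forall A, measurable A -> m A < +oo ->
    forall eps : R, (0 < eps)%R ->
    exists2 B, measurable B & dist_on m A E B < eps%:E].

(* The carrier X equipped with the sigma-algebra generated by
   [fin_approximable m].  As [fin_approximable m] is itself a sigma-algebra,
   its measurable sets are exactly the sets in [fin_approximable m]
   (see [measurable_g_measurableTypeE]), so that a measure on
   [approx_type m] is a measure on [fin_approximable m]. *)
Notation approx_type m := (g_sigma_algebraType (fin_approximable m)).

(* Main.v *)
Require Import Defs.
From HB Require Import structures.
From mathcomp Require Import all_boot all_order all_algebra.
From mathcomp Require Import all_classical all_reals all_analysis.

Set Implicit Arguments.
Unset Strict Implicit.
Unset Printing Implicit Defensive.

Import Order.TTheory GRing.Theory Num.Theory.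

Local Open Scope classical_set_scope.
Local Open Scope ring_scope.
Local Open Scope ereal_scope.
Local Open Scope measure_scope.

(** Why the theorem is true.  The family [fin_approximable m] is exactly the
    family of Caratheodory-measurable sets of the outer measure [m^*]
    ([fin_approximableE]).  Both conditions on a set
    [E] can be tested inside the sets [A] of the algebra with finite measure:

    - if [B] in the algebra is close to [E] on [A], then replacing [B] by [E]
      in the equality [m A = m (A `&` B) + m (A `\` B)] costs only twice the
      distance, so that [E] splits [A] additively; splitting the terms of a
      countable cover then shows that [E] splits every set additively;
    - conversely, a Caratheodory-measurable [E] is approximated on [A] by a
      finite union of the terms of a nearly optimal countable cover of
      [A `&` E].

    Caratheodory's theorem therefore provides the sigma-algebra, and the
    restriction of [m^*] to it as an extension of [m].

    For uniqueness, let [mu] be any extension of [m].  Sigma-subadditivity along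
    covers gives [mu <= m^*] on all approximable sets.  On a set [A] of the
    algebra with finite measure, this inequality holds for both [A `&` E] and
    [A `\` E], whereas the two sums agree with the finite number [m A]; so both
    are equalities ([extension_fin_unique]).  A countable cover of the space by
    such sets [A] removes the restriction to [A]. *)

(** * Approximable sets are the Caratheodory-measurable sets *)

Section approximable_caratheodory.
Context d (X : algebraOfSetsType d) (R : realType).
Variable m : {measure set X -> \bar R}.
Implicit Types A B E : set X.

Lemma mu_ext_le A : measurable A -> m^* A <= m A.
Proof. by move=> mA; rewrite measurable_mu_extE. Qed.

Lemma le_mu_ext_dist_on A E B :
  m^* (A `&` E) <= m^* (A `&` B) + dist_on m A E B.
Proof.
apply: le_trans (outer_measureU2 _ _ _); apply: le_outer_measure => x [Ax Ex].
by have [Bx|nBx] := pselect (B x); [left|right; split=> //; left].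
Qed.

Lemma dist_onC A E B : dist_on m A (~` E) (~` B) = dist_on m A E B.
Proof.
rewrite /dist_on; congr (m^* (A `&` _)).
by rewrite !setY_def !setDE !setCK setUC [B `&` _]setIC [E `&` _]setIC.
Qed.

(** Every set is covered by sequences in the algebra, and the terms of a cover
    with infinite measure satisfy the inequality for free. *)
Lemma caratheodory_fin E :
    (forall A, measurable A -> m A < +oo ->
      m^* (A `&` E) + m^* (A `&` ~` E) <= m A) ->
  (m^*).-caratheodory E.
Proof.
move=> splitE; apply: le_caratheodory_measurable => Y.
apply: le_ereal_inf_tmp => _ [F [mF YF] <-].
have cover_le G : m^* (Y `&` G) <= \sum_(k <oo) m^* (F k `&` G).
  apply: le_trans (outer_measure_sigma_subadditive _ _).
  by rewrite -setI_bigcupl; apply: le_outer_measure; exact: setSI.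
apply: le_trans (leeD (cover_le E) (cover_le (~` E))) _.
rewrite -nneseriesD; [|by move=> *; exact: outer_measure_ge0..].
apply: lee_nneseries => k _.
  by rewrite adde_ge0 ?outer_measure_ge0.
have [mFk|] := ltP (m (F k)) +oo; first exact: splitE.
exact/le_trans/leey.
Qed.

Lemma fin_approximable_caratheodory E :
  fin_approximable m E -> (m^*).-caratheodory E.
Proof.
move=> apE; apply: caratheodory_fin => A mA Afin.
apply/lee_addgt0Pr => e e0.
have [B mB /ltW dAB] := apE A mA Afin (e / 2)%R (divr_gt0 e0 (ltr0n _ 2)).
have := le_mu_ext_dist_on A E B; have := le_mu_ext_dist_on A (~` E) (~` B).
rewrite dist_onC => leC le.
apply: le_trans (leeD (le_trans le (leeD2l _ dAB))
                      (le_trans leC (leeD2l _ dAB))) _.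
have splitB : m^* (A `&` B) + m^* (A `&` ~` B) = m A.
  rewrite -(measurable_mu_extE m mA).
  exact/esym/(caratheodory_measurable_mu_ext m mB A).
by rewrite addeACA splitB -EFinD -splitr.
Qed.

(** The error has two sources: the part of [A `&` E] that the first [n] terms
    of the cover miss, bounded by a tail of a convergent series, and the part of
    the cover outside [A `&` E], whose measure is the excess of the cover. *)
Lemma caratheodory_fin_approximable E :
  (m^*).-caratheodory E -> fin_approximable m E.
Proof.
move=> cE A mA Afin e e0.
have e20 : (0 < e / 2)%R by rewrite divr_gt0.
have cAE : (m^*).-caratheodory (A `&` E).
  apply: caratheodory_measurable_setI => //.
  exact: (caratheodory_measurable_mu_ext m mA).
have AEfin : m^* (A `&` E) \is a fin_num.
  rewrite ge0_fin_numE ?outer_measure_ge0//; apply: le_lt_trans Afin.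
  by rewrite -(measurable_mu_extE m mA); apply: le_outer_measure; exact: subIsetl.
have [_ [F [mF AEF] <-] sumF] := lb_ereal_inf_adherent e20 AEfin.
rewrite -/(m^* (A `&` E)) in sumF.
pose U := \bigcup_k F k.
have excess : m^* (U `&` ~` (A `&` E)) <= (e / 2)%:E.
  rewrite -(leeD2lE _ _ AEfin); apply: le_trans (ltW sumF).
  apply: le_trans (_ : m^* U <= _).
    by rewrite (cAE U) (setIidr AEF).
  apply: le_trans (outer_measure_sigma_subadditive _ _) _.
  by apply: lee_nneseries => // k _; exact: mu_ext_le.
have tail0 : \sum_(N <= k <oo) m (F k) @[N --> \oo] --> 0.
  by apply: nneseries_tail_cvg => //; apply: lt_le_trans sumF (leey _).
have [n tailn] : exists n, \sum_(n <= k <oo) m (F k) < (e / 2)%:E.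
  have e2E : 0 < (e / 2)%:E by rewrite lte_fin.
  by have [n _ /(_ n (leqnn n))] := tail0 _ (open_ereal_lt' e2E); exists n.
exists (\big[setU/set0]_(k < n) F k); first exact: bigsetU_measurable.
set B := \big[setU/set0]_(k < n) F k.
have missed : m^* (A `&` E `&` ~` B) < (e / 2)%:E.
  apply: le_lt_trans tailn.
  apply: le_trans (_ : m^* (\bigcup_(k in ~` `I_n) F k) <= _).
    apply: le_outer_measure => x [/AEF[k _ Fkx] nBx]; exists k => //= kn.
    by apply: nBx; rewrite /B -bigcup_mkord; exists k.
  apply: le_trans (outer_measure_sigma_subadditive_tail _ _ _) _.
  by apply: lee_nneseries => // k _; exact: mu_ext_le.
rewrite (splitr e) EFinD.
apply: le_lt_trans (lte_leD _ missed (lexx (e / 2)%:E)) => //.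
apply: le_trans (leeD2l _ excess).
apply: le_trans (outer_measureU2 _ _ _); apply: le_outer_measure.
move=> x [Ax [[Ex nBx]|[Bx nEx]]]; [by left|right; split; last by case].
by move: Bx; rewrite /B -bigcup_mkord => -[k _ Fkx]; exists k.
Qed.

Lemma fin_approximableE : fin_approximable m = (m^*).-caratheodory.
Proof.
apply/seteqP; split=> E.
  exact: fin_approximable_caratheodory.
exact: caratheodory_fin_approximable.
Qed.

Lemma sigma_algebra_fin_approximable :
  sigma_algebra [set: X] (fin_approximable m).
Proof.
rewrite fin_approximableE; split.
- exact: caratheodory_measurable_set0.
- by move=> E cE; rewrite setTD; exact: caratheodory_measurable_setC.
- by move=> F cF; exact: caratheodory_measurable_bigcup.
Qed.

Lemma measurable_fin_approximable A : measurable A -> fin_approximable m A.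
Proof.
move=> mA; rewrite fin_approximableE.
exact: (caratheodory_measurable_mu_ext m mA).
Qed.

Lemma measurable_approx_typeE :
  (fin_approximable m).-sigma.-measurable = fin_approximable m.
Proof. exact/measurable_g_measurableTypeE/sigma_algebra_fin_approximable. Qed.

End approximable_caratheodory.

(** * Extensions of the measure to the approximable sets *)

(** The restriction of [m^*], attached to the type of approximable sets so that
    it can carry a structure of measure there. *)
Definition approx_ext d (X : algebraOfSetsType d) (R : realType)
  (m : {measure set X -> \bar R}) : set (approx_type m) -> \bar R := m^*.
Arguments approx_ext {d X R} m _.

Section approx_ext_measure.
Context d (X : algebraOfSetsType d) (R : realType).
Variable m : {measure set X -> \bar R}.

Let approx_ext0 : approx_ext m set0 = 0.
Proof. exact: outer_measure0. Qed.

Let approx_ext_ge0 E : 0 <= approx_ext m E.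
Proof. exact: outer_measure_ge0. Qed.

Let approx_ext_semi_sigma_additive : semi_sigma_additive (approx_ext m).
Proof.
move=> F; rewrite measurable_approx_typeE fin_approximableE => mF tF mUF.
exact: (@caratheodory_measure_sigma_additive R X m^*).
Qed.

HB.instance Definition _ := isMeasure.Build _ _ _ (approx_ext m)
  approx_ext0 approx_ext_ge0 approx_ext_semi_sigma_additive.

End approx_ext_measure.

Section uniqueness.
Context d (X : algebraOfSetsType d) (R : realType).
Variable m : {measure set X -> \bar R}.
Variable mu : {measure set (approx_type m) -> \bar R}.
Hypothesis mu_m : forall A : set X, measurable A -> mu A = m A.

Lemma extension_le_mu_ext (E : set X) : fin_approximable m E -> mu E <= m^* E.
Proof.
move=> apE; apply: le_ereal_inf_tmp => _ [F [mF EF] <-].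
under eq_eseriesr do rewrite -mu_m//.
apply: measure_sigma_subadditive => //=.
  by move=> k; rewrite measurable_approx_typeE; exact: measurable_fin_approximable.
by rewrite measurable_approx_typeE.
Qed.

(** The inequality [mu <= m^*] holds for both pieces of [A] cut out by [E], and
    the finite number [m A] is the sum over the pieces for [mu] and for [m^*]. *)
Lemma extension_fin_unique (A E : set X) : measurable A -> m A < +oo ->
  fin_approximable m E -> mu (A `&` E) = m^* (A `&` E).
Proof.
move=> mA Afin apE.
have mE : measurable (E : set (approx_type m)) by exact: sub_sigma_algebra.
have mA' : measurable (A : set (approx_type m)).
  by apply: sub_sigma_algebra; exact: measurable_fin_approximable.
have mAE : measurable (A `&` E : set (approx_type m)) by exact: measurableI.
have mAnE : measurable (A `\` E : set (approx_type m)) by exact: measurableD.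
have le1 : mu (A `&` E) <= m^* (A `&` E).
  by apply: extension_le_mu_ext; rewrite -measurable_approx_typeE.
have le2 : mu (A `\` E) <= m^* (A `\` E).
  by apply: extension_le_mu_ext; rewrite -measurable_approx_typeE.
have split_mu : m A = mu (A `\` E) + mu (A `&` E).
  by rewrite -mu_m//; exact: (measureDI mu mA' mE).
have split_ext : m A = m^* (A `\` E) + m^* (A `&` E).
  rewrite -(measurable_mu_extE m mA).
  exact: (measureDI (approx_ext m) mA' mE).
have fin_ext : m^* (A `\` E) \is a fin_num.
  rewrite ge0_fin_numE ?outer_measure_ge0//; apply: le_lt_trans Afin.
  by rewrite split_ext leeDl// outer_measure_ge0.
apply/eqP; rewrite eq_le le1/= -(leeD2lE _ _ fin_ext) -split_ext split_mu.
exact: leeD2r.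
Qed.

Lemma extension_unique (E : set X) : sigma_finite [set: X] m ->
  fin_approximable m E -> mu E = m^* E.
Proof.
move=> [D DT mD] apE; rewrite -[RHS]/(approx_ext m E).
apply: (@g_sigma_algebra_measure_unique_cover _ R (approx_type m)
  (fin_approximable m) _ D _ _ mu (approx_ext m)).
- exact: sub_sigma_algebra.
- by move=> i; apply: measurable_fin_approximable; exact: (mD i).1.
- by rewrite -DT.
- move=> n F sF; have [mDn Dnfin] := mD n; apply: extension_fin_unique => //.
  by rewrite -measurable_approx_typeE.
- exact: sub_sigma_algebra.
Qed.

End uniqueness.

Theorem theorem1p3 (d : measure_display) (X : algebraOfSetsType d)
    (R : realType) (m : {measure set X -> \bar R}) :
  [/\ sigma_algebra [set: X] (fin_approximable m),
      forall A : set X, measurable A -> fin_approximable m A,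
      exists mbar : {measure set (approx_type m) -> \bar R},
        (forall E : set X, fin_approximable m E -> mbar E = m^* E) /\
        (forall A : set X, measurable A -> mbar A = m A)
    & sigma_finite [set: X] m ->
      forall mtilde : {measure set (approx_type m) -> \bar R},
        (forall A : set X, measurable A -> mtilde A = m A) ->
        forall E : set X, fin_approximable m E -> mtilde E = m^* E].
Proof.
split.
- exact: sigma_algebra_fin_approximable.
- exact: measurable_fin_approximable.
- by exists (approx_ext m); split=> // A mA; exact: measurable_mu_extE.
- by move=> sfin mtilde mtilde_ext E; exact: extension_unique.
Qed.
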